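(* For every integer $n\ge 1$, $\operatorname{cf}(\mathcal M^{sep}_{\le\aleph_n},\le)\le\operatorname{cf}(\mathcal M_{\aleph_n},\le)$.
   Context: For $\lambda>1$, an injection $f$ is $\lambda$-bi-Lipschitz if for all distinct $a,b$ in its domain $d(f(a),f(b))<\lambda d(a,b)$ and $d(a,b)<\lambda d(f(a),f(b))$; $X$ is almost isometrically embedded in $Y$ ($X\le Y$) if for every $\lambda>1$ there is a $\lambda$-bi-Lipschitz injection $X\to Y$. $\mathcal M^{sep}_{\le\aleph_n}$ is the class of (isometry types of) separable metric spaces of cardinality at most $\aleph_n$, and $\mathcal M_{\aleph_n}$ the class of (isometry types of) metric spaces of cardinality $\aleph_n$, both quasi-ordered by $\le$. For such a class $\mathcal C$, $\operatorname{cf}(\mathcal C,\le)$ is the least cardinality of a set $D\subseteq\mathcal C$ such that every $M\in\mathcal C$ satisfies $M\le N$ for some $N\in D$. *)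

(* Defs.v *)
From Stdlib Require Import Reals.
Open Scope R_scope.

Record MetricSpace := MkMetricSpace {
  carrier :> Type;
  dist : carrier -> carrier -> R;
  dist_eq0 : forall x y, dist x y = 0 <-> x = y;
  dist_sym : forall x y, dist x y = dist y x;
  dist_tri : forall x y z, dist x z <= dist x y + dist y z
}.

Definition injective {A B : Type} (f : A -> B) : Prop :=
  forall a b, f a = f b -> a = b.

Fixpoint card_le_aleph (n : nat) (X : Type) : Prop :=
  match n with
  | O => exists f : X -> nat, injective f
  | S m => exists lt : X -> X -> Prop,
      (forall x y z, lt x y -> lt y z -> lt x z) /\
      (forall x y, lt x y \/ x = y \/ lt y x) /\
      well_founded lt /\
      (forall x, card_le_aleph m {y : X | lt y x})
  end.

Definition card_eq_aleph (n : nat) (X : Type) : Prop :=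
  match n with
  | O => exists f : X -> nat, injective f /\ (forall k, exists x, f x = k)
  | S m => card_le_aleph (S m) X /\ ~ card_le_aleph m X
  end.

Definition bi_lipschitz (X Y : MetricSpace) (lam : R) (f : X -> Y) : Prop :=
  injective f /\
  forall a b : X, a <> b ->
    dist Y (f a) (f b) < lam * dist X a b /\ dist X a b < lam * dist Y (f a) (f b).

Definition almost_embeds (X Y : MetricSpace) : Prop :=
  forall lam : R, 1 < lam -> exists f : X -> Y, bi_lipschitz X Y lam f.

Definition separable (X : MetricSpace) : Prop :=
  exists D : X -> Prop,
    (exists f : {x : X | D x} -> nat, injective f) /\
    (forall x eps, 0 < eps -> exists y, D y /\ dist X x y < eps).

(* Main.v *)
(** Take [J = I].  For each [N i] we build one separable space of cardinality at most
    aleph_n that contains an isometric copy of every separable subspace of [N i].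

    The countable subsets of aleph_n have cofinality at most aleph_n, so aleph_n many
    closures of sequences [e : nat -> N i] absorb all separable subspaces.  These
    closures are amalgamated, up to identifying points at distance 0, by

      d((e,x),(e',x')) = inf_c d(x, e c) + d(x', e' c)
                               + sum_(a < b <= c) |d(e a, e b) - d(e' a, e' b)|.

    For [e = e'] this is the original distance, and the space is separable because
    near [e c] only the finite matrix of distances between [e 0, ..., e c] matters.

    A separable [M] is extended by a discrete space to cardinality exactly aleph_n and
    thereby embedded in some [N i]; the images of [M] for [lam = 1 + 1/k], over all [k],
    together have a countable dense set, so one closure works for every [lam]. *)

From Stdlib Require Import Reals ZArith Lra Lia List Cantor Wellfounded Classical ClassicalEpsilon.
From Stdlib Require Import FunctionalExtensionality PropExtensionality ProofIrrelevance.
From mathcomp Require boolp wochoice.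
Require Import Defs.

(** * Injections, choice and well-orders *)

Definition embeds (A B : Type) : Prop := exists f : A -> B, injective f.

Lemma embeds_trans (A B C : Type) : embeds A B -> embeds B C -> embeds A C.
Proof.
intros [f hf] [g hg]; exists (fun a => g (f a)).
intros a b h; apply hf, hg, h.
Qed.

Lemma embeds_sub (A : Type) (P Q : A -> Prop) :
  (forall a, P a -> Q a) -> embeds {a | P a} {a | Q a}.
Proof.
intros h; exists (fun a => exist Q (proj1_sig a) (h _ (proj2_sig a))).
intros [a ha] [b hb] e; injection e; intros e'.
apply subset_eq_compat, e'.
Qed.

Lemma embeds_sig (A : Type) (P : A -> Prop) : embeds {a | P a} A.
Proof.
exists (@proj1_sig A P); intros [a ha] [b hb] e; apply subset_eq_compat, e.
Qed.

Lemma dependent_choice (A : Type) (B : A -> Type) (P : forall a, B a -> Prop) :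
  (forall a, exists b, P a b) -> exists f : forall a, B a, forall a, P a (f a).
Proof.
intros h; exists (fun a => proj1_sig (constructive_indefinite_description _ (h a))).
intros a; exact (proj2_sig (constructive_indefinite_description _ (h a))).
Qed.

Lemma embeds_of_onto (A B : Type) (g : B -> A) :
  (forall a, exists b, g b = a) -> embeds A B.
Proof.
intros h; destruct (choice (fun a b => g b = a) h) as [f hf].
exists f; intros a b e; rewrite <- (hf a), <- (hf b), e; reflexivity.
Qed.

Lemma cantor_no_embedding (A : Type) : ~ embeds (A -> Prop) A.
Proof.
intros [f hf].
set (D := fun a => exists P : A -> Prop, f P = a /\ ~ P a).
assert (h : ~ D (f D)).
{ intros h; pose proof h as [P [e nP]]; apply hf in e; subst P; exact (nP h). }
apply h; exists D; split; [reflexivity | exact h].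
Qed.

Definition strict_well_order (X : Type) (lt : X -> X -> Prop) : Prop :=
  (forall x y z, lt x y -> lt y z -> lt x z) /\
  (forall x y, lt x y \/ x = y \/ lt y x) /\
  well_founded lt.

Lemma wf_minimum (X : Type) (lt : X -> X -> Prop) (P : X -> Prop) :
  well_founded lt -> (exists x, P x) ->
  exists x, P x /\ forall y, lt y x -> ~ P y.
Proof.
intros wf [x px]; apply NNPP; intros h.
revert px; induction (wf x) as [x _ ih]; intros px.
apply h; exists x; split; [exact px | exact ih].
Qed.

Lemma wf_irrefl (X : Type) (lt : X -> X -> Prop) :
  well_founded lt -> forall x, ~ lt x x.
Proof.
intros wf x; induction (wf x) as [x _ ih]; intros h; exact (ih x h h).
Qed.

(** The boolean well-ordering principle gives every nonempty predicate a unique least element. Least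
    elements of sets of two or three points then yield totality, antisymmetry and transitivity, and
    [lt] is the strict part. *)
Lemma zermelo (X : Type) : exists lt : X -> X -> Prop, strict_well_order X lt.
Proof.
destruct (wochoice.well_ordering_principle
  (eqtype.Equality.Pack (eqtype.Equality.Class (boolp.gen_eqMixin X)))) as [Rb wo].
cbn in Rb, wo.
set (le := fun x y : X => Rb x y = true).
assert (mins : forall P : X -> Prop, (exists x, P x) ->
  exists z, (P z /\ forall y, P y -> le z y) /\
    forall z', P z' -> (forall y, P y -> le z' y) -> z = z').
{ intros P [x px].
  destruct (wo (fun x => boolp.asbool (P x))) as [z [[hz lb] uniq]].
  { exists x; apply boolp.asboolT, px. }
  exists z; split; [split |].
  - apply boolp.asboolW, hz.
  - intros y py; apply lb, boolp.asboolT, py.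
  - intros z' pz' lz'; apply uniq; split.
    + apply boolp.asboolT, pz'.
    + intros y py; apply lz'; apply boolp.asboolW, py. }
assert (tot : forall x y, le x y \/ le y x).
{ intros x y; destruct (mins (fun z => z = x \/ z = y)) as [z [[[-> | ->] hz] _]]; eauto. }
assert (refl : forall x, le x x) by (intros x; destruct (tot x x); assumption).
assert (anti : forall x y, le x y -> le y x -> x = y).
{ intros x y lxy lyx.
  destruct (mins (fun z => z = x \/ z = y)) as [z [[[-> | ->] hz] u]]; eauto.
  - apply u; [auto | intros w [-> | ->]; auto].
  - symmetry; apply u; [auto | intros w [-> | ->]; auto]. }
exists (fun x y => le x y /\ x <> y); refine (conj _ (conj _ _)).
- intros x y z [lxy nxy] [lyz _]; split;
    [| intros <-; exact (nxy (anti _ _ lxy lyz))].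
  destruct (mins (fun w => w = x \/ w = y \/ w = z))
    as [w [[[-> | [-> | ->]] hw] _]]; eauto.
  + rewrite (anti x y lxy (hw x (or_introl eq_refl))); exact lyz.
  + rewrite (anti y z lyz (hw y (or_intror (or_introl eq_refl)))) in lxy; exact lxy.
- intros x y; destruct (classic (x = y)) as [e | ne]; [auto |].
  destruct (tot x y); [left | right; right]; auto.
- intros x; apply NNPP; intros nx.
  destruct (mins (fun z => ~ Acc (fun x y => le x y /\ x <> y) z)) as [z [[nz hz] _]];
    [eauto |].
  apply nz; constructor; intros y [lyz nyz]; apply NNPP; intros ny.
  exact (nyz (anti _ _ lyz (hz y ny))).
Qed.

(** * Arithmetic of cardinalities at most aleph_n *)

Lemma card_le_aleph_embeds (n : nat) :
  forall A B : Type, embeds A B -> card_le_aleph n B -> card_le_aleph n A.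
Proof.
induction n as [| m ih]; intros A B [f hf].
{ intros hB; apply (embeds_trans A B nat); [exists f; exact hf | exact hB]. }
intros [lt [tr [tot [wf seg]]]].
exists (fun x y => lt (f x) (f y)); refine (conj _ (conj _ (conj _ _))).
- intros x y z; apply tr.
- intros x y; destruct (tot (f x) (f y)) as [h | [h | h]]; auto.
- exact (wf_inverse_image A B lt f wf).
- intros x; apply (ih _ {b | lt b (f x)}); [| apply seg].
  exists (fun y : {y | lt (f y) (f x)} =>
    exist (fun b => lt b (f x)) (f (proj1_sig y)) (proj2_sig y)).
  intros [a ha] [b hb] e; injection e; intros e'.
  apply subset_eq_compat, hf, e'.
Qed.

Lemma card_le_aleph_option (n : nat) :
  forall A : Type, card_le_aleph n A -> card_le_aleph n (option A).
Proof.
induction n as [| m ih]; intros A.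
{ intros [f hf].
  exists (fun o => match o with Some a => S (f a) | None => O end).
  intros [a |] [b |] e; try discriminate; [| reflexivity].
  injection e; intros e'; f_equal; apply hf, e'. }
intros [lt [tr [tot [wf seg]]]].
(* [None] goes below all of [A]: the segment below [Some x] is the segment below [x] with one point
   added, which the induction hypothesis handles. *)
set (lt' := fun o p : option A => match o, p with
  | Some a, Some b => lt a b | None, Some _ => True | _, None => False end).
exists lt'; refine (conj _ (conj _ (conj _ _))).
- intros [x |] [y |] [z |]; simpl; eauto; tauto.
- intros [x |] [y |]; simpl; auto.
  destruct (tot x y) as [h | [-> | h]]; auto.
- assert (aN : Acc lt' None) by (constructor; intros [y |] []).
  intros [x |]; [| exact aN].
  induction (wf x) as [x _ ihx]; constructor; intros [y |] h; auto.
- intros [x |].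
  + apply (card_le_aleph_embeds m _ (option {a | lt a x})); [| apply ih, seg].
    exists (fun o : {o | lt' o (Some x)} => match o with
      | exist (Some a) h => Some (exist (fun a => lt a x) a h)
      | exist None _ => None end).
    intros [[a |] ha] [[b |] hb] e; try discriminate.
    * injection e; intros e'; apply subset_eq_compat; congruence.
    * apply subset_eq_compat; reflexivity.
  + apply (card_le_aleph_embeds m _ {a : option A | False}).
    * apply embeds_sub; intros [a |] [].
    * clear. induction m as [| m ihm].
      -- exists (fun _ => O); intros [? []].
      -- exists (fun _ _ => False); refine (conj _ (conj _ (conj _ _))); intros [? []].
Qed.

(* A rank function with small bounded pieces suffices: break ties inside the
   fibres by an arbitrary well-order. *)
Lemma card_le_aleph_rank (m : nat) (X W : Type) (lt : W -> W -> Prop) (r : X -> W) :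
  strict_well_order W lt ->
  (forall w, card_le_aleph m {x | ~ lt w (r x)}) -> card_le_aleph (S m) X.
Proof.
intros [tr [tot wf]] small.
destruct (zermelo X) as [ltX [trX [totX wfX]]].
exists (fun x y => lt (r x) (r y) \/ (r x = r y /\ ltX x y)); refine (conj _ (conj _ (conj _ _))).
- intros x y z [h | [e h]] [h' | [e' h']].
  + left; eauto.
  + left; rewrite <- e'; exact h.
  + left; rewrite e; exact h'.
  + right; split; [congruence | eauto].
- intros x y; destruct (tot (r x) (r y)) as [h | [h | h]]; auto.
  destruct (totX x y) as [h' | [h' | h']]; auto.
- assert (acc : forall w x, r x = w ->
    Acc (fun x y => lt (r x) (r y) \/ (r x = r y /\ ltX x y)) x).
  { intros w; induction (wf w) as [w _ ihw]; intros x.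
    induction (wfX x) as [x _ ihx]; intros e.
    constructor; intros y [h | [e' h]].
    - rewrite e in h; exact (ihw _ h y eq_refl).
    - apply ihx; congruence. }
  intros x; exact (acc _ x eq_refl).
- intros x; apply (card_le_aleph_embeds m _ {y | ~ lt (r x) (r y)}); [| apply small].
  apply embeds_sub; intros y [h | [e _]] h'.
  + exact (wf_irrefl _ lt wf _ (tr _ _ _ h h')).
  + rewrite e in h'; exact (wf_irrefl _ lt wf _ h').
Qed.

(** A closed segment exceeds the open one only by its endpoint, which is sent to [None]. *)
Lemma card_le_aleph_closed_segment (m : nat) (X : Type) (lt : X -> X -> Prop) (x : X) :
  strict_well_order X lt ->
  card_le_aleph m {y | lt y x} -> card_le_aleph m {y | ~ lt x y}.
Proof.
intros [_ [tot _]] h.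
apply (card_le_aleph_embeds m _ (option {y | lt y x}));
  [| apply card_le_aleph_option, h].
exists (fun y => match excluded_middle_informative (lt (proj1_sig y) x) with
  | left h => Some (exist (fun y => lt y x) (proj1_sig y) h) | right _ => None end).
intros [a ha] [b hb]; simpl.
destruct (excluded_middle_informative (lt a x)) as [la | la];
  destruct (excluded_middle_informative (lt b x)) as [lb | lb]; try discriminate;
  intros e; apply subset_eq_compat.
- congruence.
- destruct (tot a x) as [? | [-> | ?]]; [tauto | | tauto].
  destruct (tot b x) as [? | [-> | ?]]; tauto.
Qed.

Lemma card_le_aleph_succ (n : nat) (X : Type) :
  card_le_aleph n X -> card_le_aleph (S n) X.
Proof.
intros h; destruct (zermelo X) as [lt [tr [tot wf]]].
exists lt; refine (conj tr (conj tot (conj wf _))).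
intros x; apply (card_le_aleph_embeds n _ X); [apply embeds_sig | exact h].
Qed.

(** Hessenberg's argument: rank pairs by their maximum. The pairs of maximum at most [w] lie in the
    square of a closed segment, which is small by induction. *)
Lemma card_le_aleph_square (n : nat) :
  forall A : Type, card_le_aleph n A -> card_le_aleph n (A * A).
Proof.
induction n as [| m ih]; intros A.
{ intros [f hf]; exists (fun p => Cantor.to_nat (f (fst p), f (snd p))).
  intros [a b] [a' b'] e.
  apply (f_equal Cantor.of_nat) in e; rewrite !Cantor.cancel_of_to in e.
  injection e; intros eb ea; simpl in *.
  apply hf in ea; apply hf in eb; congruence. }
intros [lt [tr [tot [wf seg]]]].
assert (wo : strict_well_order A lt) by exact (conj tr (conj tot wf)).
set (mx := fun p : A * A =>
  if excluded_middle_informative (lt (fst p) (snd p)) then snd p else fst p).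
apply (card_le_aleph_rank m _ A lt mx wo); intros w.
apply (card_le_aleph_embeds m _ ({a | ~ lt w a} * {a | ~ lt w a}));
  [| apply ih, card_le_aleph_closed_segment; auto].
assert (h : forall p, ~ lt w (mx p) -> ~ lt w (fst p) /\ ~ lt w (snd p)).
{ intros [a b]; unfold mx; simpl.
  destruct (excluded_middle_informative (lt a b)) as [l | l]; intros h.
  - split; [intros h'; apply h; eauto | exact h].
  - split; [exact h | intros h'; apply h].
    destruct (tot a b) as [? | [-> | ?]]; [tauto | exact h' | eauto]. }
exists (fun p => (exist (fun a => ~ lt w a) _ (proj1 (h _ (proj2_sig p))),
                  exist (fun a => ~ lt w a) _ (proj2 (h _ (proj2_sig p))))).
intros [[a b] hab] [[a' b'] hab'] e; injection e; simpl; intros eb ea.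
apply subset_eq_compat; congruence.
Qed.

(* Inject [A] into [B] by transfinite recursion; if at stage [a] nothing is left of
   [B], then [B] was exhausted by the values below [a]. *)
Lemma well_founded_compare (A B : Type) (lt : A -> A -> Prop) :
  strict_well_order A lt ->
  embeds A B \/ exists a, embeds B {a' | lt a' a}.
Proof.
intros [_ [tot wf]].
set (fresh := fun a (rec : forall a', lt a' a -> option B) b =>
  forall a' h, rec a' h <> Some b).
set (step := fun a rec =>
  match excluded_middle_informative (exists b, fresh a rec b) with
  | left h => Some (proj1_sig (constructive_indefinite_description _ h))
  | right _ => None end).
set (F := Fix wf (fun _ => option B) step).
assert (FE : forall a, F a = step a (fun a' _ => F a')).
{ intros a; refine (Init.Wf.Fix_eq wf (fun _ => option B) step _ a); intros x f g e.
  replace g with f; [reflexivity |].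
  apply functional_extensionality_dep; intros y.
  apply functional_extensionality; intros p; apply e. }
assert (Fsome : forall a b, F a = Some b -> forall a', lt a' a -> F a' <> Some b).
{ intros a b; rewrite FE; unfold step.
  destruct (excluded_middle_informative _) as [h | h]; [| discriminate].
  destruct (constructive_indefinite_description _ h) as [c hc]; simpl.
  intros e; injection e; intros <- a' h'; exact (hc a' h'). }
destruct (classic (exists a, F a = None)) as [[a ha] | h].
- right; exists a.
  rewrite FE in ha; unfold step in ha.
  destruct (excluded_middle_informative _) as [h | h]; [discriminate |].
  assert (pre : forall b, exists a' : {a' | lt a' a}, F (proj1_sig a') = Some b).
  { intros b; apply NNPP; intros nb; apply h; exists b; intros a' l e.
    apply nb; exists (exist _ a' l); exact e. }
  destruct (choice _ pre) as [g hg].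
  exists g; intros b b' e.
  pose proof (hg b) as h1; rewrite e, (hg b') in h1; congruence.
- left.
  assert (val : forall a, exists b, F a = Some b).
  { intros a; destruct (F a) as [b |] eqn:e; [eauto | exfalso; eauto]. }
  destruct (choice _ val) as [g hg].
  exists g; intros a a' e.
  destruct (tot a a') as [l | [l | l]]; [| exact l |]; exfalso.
  + apply (Fsome _ _ (hg a') _ l); rewrite hg; congruence.
  + apply (Fsome _ _ (hg a) _ l); rewrite hg; congruence.
Qed.

(** Otherwise [K] would embed in a proper initial segment of [X], of cardinality at most aleph_m. *)
Lemma card_le_aleph_succ_embeds (m : nat) (X K : Type) :
  card_le_aleph (S m) X -> ~ card_le_aleph m K -> embeds X K.
Proof.
intros [lt [tr [tot [wf seg]]]] hK.
destruct (well_founded_compare X K lt) as [h | [a h]];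
  [exact (conj tr (conj tot wf)) | exact h |].
exfalso; apply hK; exact (card_le_aleph_embeds m _ _ h (seg a)).
Qed.

Fixpoint powerset_tower (n : nat) : Type :=
  match n with O => nat -> Prop | S m => powerset_tower m -> Prop end.

(** If one more power set had cardinality at most aleph_(m+1), the previous lemma would embed it in
    the stage before, against Cantor. The towers thus supply types whose well-orders are long enough
    to cut out an aleph_(m+1). *)
Lemma powerset_tower_large (n : nat) : ~ card_le_aleph n (powerset_tower n).
Proof.
induction n as [| m ih]; intros h.
- exact (cantor_no_embedding nat h).
- exact (cantor_no_embedding _ (card_le_aleph_succ_embeds m _ _ h ih)).
Qed.

(* Cut a well-order of a large type at its first initial segment that is not of
   cardinality at most aleph_m. *)
Lemma exists_card_aleph_succ (m : nat) :
  exists K : Type, card_le_aleph (S m) K /\ ~ card_le_aleph m K.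
Proof.
destruct (zermelo (powerset_tower m)) as [lt [tr [tot wf]]].
destruct (classic (exists x, ~ card_le_aleph m {y | lt y x})) as [h | h].
- destruct (wf_minimum _ lt _ wf h) as [x [hx below]].
  exists {y | lt y x}; split; [| exact hx].
  exists (fun a b => lt (proj1_sig a) (proj1_sig b)); refine (conj _ (conj _ (conj _ _))).
  + intros a b c; apply tr.
  + intros [a ha] [b hb]; simpl.
    destruct (tot a b) as [l | [l | l]]; auto.
    right; left; apply subset_eq_compat, l.
  + exact (wf_inverse_image _ _ lt (@proj1_sig _ _) wf).
  + intros [a ha]; simpl.
    apply (card_le_aleph_embeds m _ {y | lt y a}); [| apply NNPP, below, ha].
    exists (fun b => exist (fun y => lt y a) (proj1_sig (proj1_sig b)) (proj2_sig b)).
    intros [[b hb] lb] [[c hc] lc] e; injection e; simpl; intros e'.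
    apply subset_eq_compat, subset_eq_compat, e'.
- exists (powerset_tower m); split; [| apply powerset_tower_large].
  exists lt; refine (conj tr (conj tot (conj wf _))).
  intros x; apply NNPP; intros hx; apply h; eauto.
Qed.

Lemma exists_universal_card_aleph (n : nat) :
  exists K : Type, card_le_aleph n K /\ forall X, card_le_aleph n X -> embeds X K.
Proof.
destruct n as [| m].
- exists nat; split; [exists (fun k => k); intros a b e; exact e | intros X h; exact h].
- destruct (exists_card_aleph_succ m) as [K [hK nK]].
  exists K; split; [exact hK | intros X hX; exact (card_le_aleph_succ_embeds m X K hX nK)].
Qed.

(** Each point is coded in [K * K] by its value under [f] and its place in the fibre. This is the
    bound on unions of aleph_n many sets of cardinality at most aleph_n. *)
Lemma card_le_aleph_fibres (n : nat) (X A : Type) (f : X -> A) :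
  card_le_aleph n A -> (forall a, card_le_aleph n {x | f x = a}) -> card_le_aleph n X.
Proof.
intros hA hf; destruct (exists_universal_card_aleph n) as [K [hK univ]].
destruct (univ A hA) as [g hg].
destruct (dependent_choice A (fun a => {x | f x = a} -> K) (fun a h => injective h)
  (fun a => univ _ (hf a))) as [h hh].
apply (card_le_aleph_embeds n _ (K * K)); [| apply card_le_aleph_square, hK].
exists (fun x => (g (f x), h (f x) (exist _ x eq_refl))).
(* The codes [h (f x)] and [h (f y)] act on different fibre types; generalizing the base point to
   [a] moves both points into one fibre, where injectivity applies. *)
assert (key : forall x a (e : f x = a) y, f y = a ->
  h (f x) (exist _ x eq_refl) = h (f y) (exist _ y eq_refl) -> x = y).
{ intros x a e y e' eh.
  assert (eh' : h a (exist _ x e) = h a (exist _ y e')).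
  { destruct e'; rewrite <- eh; clear eh; destruct e; reflexivity. }
  apply hh in eh'; congruence. }
intros x y e; injection e; intros e2 e1; apply hg in e1.
exact (key x _ e1 y eq_refl e2).
Qed.

Lemma card_le_aleph_sum (n : nat) (A B : Type) :
  card_le_aleph n A -> card_le_aleph n B -> card_le_aleph n (A + B).
Proof.
intros hA hB; destruct (exists_universal_card_aleph n) as [K [hK univ]].
destruct (univ A hA) as [f hf], (univ B hB) as [g hg].
apply (card_le_aleph_embeds n _ (option K * option K));
  [| apply card_le_aleph_square, card_le_aleph_option, hK].
exists (fun s => match s with
  | inl a => (Some (f a), None) | inr b => (None, Some (g b)) end).
intros [a | b] [a' | b'] e; try discriminate; injection e; intros e'; f_equal; auto.
Qed.

Lemma card_le_aleph_nat (n : nat) : card_le_aleph n nat.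
Proof.
induction n as [| m ih]; [exists (fun k => k); intros a b e; exact e |].
apply card_le_aleph_succ, ih.
Qed.

(* The cofinality of the countable subsets of aleph_n is at most aleph_n: if [X] is
   not of cardinality at most aleph_m, every sequence in [X] is bounded. *)
Lemma countable_covering (n : nat) :
  forall X : Type, card_le_aleph n X ->
  exists (T : Type) (E : T -> nat -> X), card_le_aleph n T /\
    forall s : nat -> X, exists t, forall k, exists j, E t j = s k.
Proof.
induction n as [| m ih]; intros X hX.
{ destruct hX as [f hf].
  (* Every index gives an enumeration of all of [X]; the index [x] only provides the default value
     outside the range of [f], so an empty [X] causes no trouble. *)
  exists X, (fun x k => epsilon (inhabits x) (fun y => f y = k)); split;
    [exists f; exact hf |].
  intros s; exists (s O); intros k; exists (f (s k)); apply hf.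
  apply epsilon_spec; eauto. }
destruct (classic (card_le_aleph m X)) as [hm | hm].
{ destruct (ih X hm) as [T [E [hT hE]]].
  exists T, E; split; [apply card_le_aleph_succ, hT | exact hE]. }
pose proof hX as [lt [tr [tot [wf seg]]]].
assert (wo : strict_well_order X lt) by exact (conj tr (conj tot wf)).
destruct (dependent_choice X (fun x => {T : Type & T -> nat -> {y | lt y x}}) (fun x c =>
  card_le_aleph m (projT1 c) /\
  forall s : nat -> {y | lt y x}, exists t, forall k, exists j, projT2 c t j = s k))
  as [c hc].
{ intros x; destruct (ih _ (seg x)) as [T [E h]]; exists (existT _ T E); exact h. }
(* The covering families of all the proper initial segments are put together. *)
exists {x : X & projT1 (c x)}, (fun t j => proj1_sig (projT2 (c (projT1 t)) (projT2 t) j)).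
split.
- apply (card_le_aleph_fibres (S m) _ X (@projT1 _ _) hX); intros x.
  apply card_le_aleph_succ, (card_le_aleph_embeds m _ (projT1 (c x))); [| apply hc].
  apply (embeds_of_onto _ _ (fun t => exist (fun p => projT1 p = x)
    (existT (fun x => projT1 (c x)) x t) eq_refl)).
  intros [[y t] e]; simpl in e; subst y; exists t; reflexivity.
- intros s; destruct (classic (exists x, forall k, lt (s k) x)) as [[x hx] | unb].
  + destruct (proj2 (hc x) (fun k => exist _ (s k) (hx k))) as [t ht].
    exists (existT _ x t); intros k; destruct (ht k) as [j hj]; exists j.
    simpl; rewrite hj; reflexivity.
  (* An unbounded sequence would make [X] the union of the closed segments ending at the [s k]:
     countably many sets of cardinality at most aleph_m. *)
  + exfalso; apply hm.
    assert (above : forall x, exists k, ~ lt (s k) x).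
    { intros x; apply NNPP; intros h; apply unb; exists x; intros k.
      apply NNPP; eauto. }
    destruct (choice _ above) as [f hf].
    apply (card_le_aleph_fibres m X nat f); [apply card_le_aleph_nat |]; intros k.
    apply (card_le_aleph_embeds m _ {x | ~ lt (s k) x}).
    * apply embeds_sub; intros x <-; apply hf.
    * apply card_le_aleph_closed_segment; auto.
Qed.

Fixpoint list_code (l : list nat) : nat :=
  match l with nil => O | a :: l' => S (Cantor.to_nat (a, list_code l')) end.

Lemma list_nat_countable : embeds (list nat) nat.
Proof.
exists list_code.
intros l; induction l as [| a l ih]; intros [| b l'] e; try discriminate; [reflexivity |].
apply Nat.succ_inj in e as e'.
apply (f_equal Cantor.of_nat) in e'; rewrite !Cantor.cancel_of_to in e'.
injection e'; intros el ->; f_equal; apply ih, el.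
Qed.

(** * Separability and metric quotients *)

Lemma dist_refl (M : MetricSpace) (x : M) : dist M x x = 0.
Proof. apply dist_eq0; reflexivity. Qed.

Lemma dist_nonneg (M : MetricSpace) (x y : M) : 0 <= dist M x y.
Proof.
pose proof (dist_tri M x y x) as h.
rewrite dist_refl, (dist_sym M y x) in h; lra.
Qed.

Lemma separable_of_countable_cover (M : MetricSpace) (L : Type) (P : L -> M -> Prop) :
  embeds L nat ->
  (forall x eps, 0 < eps ->
     exists l, P l x /\ forall y z, P l y -> P l z -> dist M y z < eps) ->
  separable M.
Proof.
intros hL hP.
(* One point is chosen in each nonempty [P l]. The point [x0] is the inhabitant that [epsilon] asks
   for; by proof irrelevance the choice does not depend on it. *)
set (rep := fun l x => P l x /\ exists x0, x = epsilon (inhabits x0) (P l)).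
assert (irr : forall l x y, rep l x -> rep l y -> x = y).
{ intros l x y [_ [x0 hx]] [_ [y0 hy]]; rewrite hx, hy; f_equal; apply proof_irrelevance. }
exists (fun x => exists l, rep l x); split.
- apply (embeds_trans _ L nat); [| exact hL].
  destruct (dependent_choice {x | exists l, rep l x} (fun _ => L)
    (fun x l => rep l (proj1_sig x)) (@proj2_sig _ _)) as [f hf].
  exists f; intros [x hx] [y hy] e; apply subset_eq_compat.
  pose proof (hf (exist _ x hx)) as h1; pose proof (hf (exist _ y hy)) as h2.
  rewrite e in h1; exact (irr _ _ _ h1 h2).
- intros x eps heps; destruct (hP x eps heps) as [l [hx hl]].
  exists (epsilon (inhabits x) (P l)).
  assert (h : P l (epsilon (inhabits x) (P l))) by (apply epsilon_spec; eauto).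
  split; [exists l; split; eauto | apply hl; assumption].
Qed.

Lemma separable_dense_sequence (M : MetricSpace) (x0 : M) :
  separable M ->
  exists s : nat -> M, forall x eps, 0 < eps -> exists k, dist M x (s k) < eps.
Proof.
intros [D [[f hf] dense]].
exists (fun k => epsilon (inhabits x0) (fun x => exists h : D x, f (exist _ x h) = k)).
intros x eps heps; destruct (dense x eps heps) as [y [hy l]].
exists (f (exist _ y hy)).
destruct (epsilon_spec (inhabits x0)
  (fun x => exists h : D x, f (exist _ x h) = f (exist _ y hy))) as [h e];
  [eauto |].
apply hf in e; injection e; intros ->; exact l.
Qed.

(** The quotient is realized on canonical representatives: points at distance 0 satisfy the same
    predicate [rho p q = 0] in [q], so [epsilon] picks the same point for both. *)
Lemma metric_quotient (P : Type) (rho : P -> P -> R) :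
  (forall p, rho p p = 0) -> (forall p q, rho p q = rho q p) ->
  (forall p q r, rho p r <= rho p q + rho q r) ->
  exists (Q : MetricSpace) (pi : P -> Q),
    (forall u, exists p, pi p = u) /\ forall p q, dist Q (pi p) (pi q) = rho p q.
Proof.
intros refl sym tri.
assert (nonneg : forall p q, 0 <= rho p q).
{ intros p q; pose proof (tri p q p) as h; rewrite refl, (sym q p) in h; lra. }
set (rep := fun p => epsilon (inhabits p) (fun q => rho p q = 0)).
assert (hrep : forall p, rho p (rep p) = 0).
{ intros p; apply (epsilon_spec (inhabits p) (fun q => rho p q = 0)); eauto. }
assert (rep_eq : forall p q, rho p q = 0 -> rep p = rep q).
{ intros p q h; unfold rep.
  rewrite (proof_irrelevance _ (inhabits p) (inhabits q)); f_equal.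
  apply functional_extensionality; intros r; apply propositional_extensionality.
  pose proof (tri p q r); pose proof (tri q p r); pose proof (nonneg p r);
    pose proof (nonneg q r); pose proof (sym p q); split; lra. }
assert (idem : forall p, rep (rep p) = rep p).
{ intros p; symmetry; apply rep_eq, hrep. }
unshelve eexists (MkMetricSpace {p | rep p = p}
  (fun a b => rho (proj1_sig a) (proj1_sig b)) _ _ _),
  (fun p => exist (fun p => rep p = p) (rep p) (idem p)).
- intros [p hp] [q hq]; simpl; split.
  + intros h; apply subset_eq_compat; rewrite <- hp, <- hq; apply rep_eq, h.
  + intros e; injection e; intros ->; apply refl.
- intros a b; apply sym.
- intros a b c; apply tri.
- split.
  + intros [p hp]; exists p; apply subset_eq_compat, hp.
  + intros p q; simpl.
    pose proof (tri (rep p) p (rep q)); pose proof (tri p q (rep q)).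
    pose proof (tri p (rep p) q); pose proof (tri (rep p) (rep q) q).
    pose proof (hrep p); pose proof (hrep q).
    rewrite (sym (rep p) p) in *; rewrite (sym (rep q) q) in *; lra.
Qed.

(** * Infima and finite sums *)

Definition infimum (f : nat -> R) : R :=
  epsilon (inhabits 0) (fun m => (forall c, m <= f c) /\
    forall eps, 0 < eps -> exists c, f c < m + eps).

Lemma infimum_spec (f : nat -> R) :
  (forall c, 0 <= f c) ->
  (forall c, infimum f <= f c) /\
  forall eps, 0 < eps -> exists c, f c < infimum f + eps.
Proof.
intros hf; apply (epsilon_spec (inhabits 0) (fun m => (forall c, m <= f c) /\
    forall eps, 0 < eps -> exists c, f c < m + eps)).
destruct (completeness (fun r => exists c, r = - f c)) as [m [ub lub]].
- exists 0; intros r [c ->]; specialize (hf c); lra.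
- exists (- f O); eauto.
- exists (- m); split.
  + intros c; assert (- f c <= m) by (apply ub; eauto); lra.
  + intros eps heps; apply NNPP; intros h.
    assert (m <= m - eps); [| lra].
    apply lub; intros r [c ->]; apply Rnot_lt_le; intros l; apply h; exists c; lra.
Qed.

Definition list_sum {A : Type} (f : A -> R) (l : list A) : R :=
  fold_right (fun a s => f a + s) 0 l.

Lemma list_sum_app {A : Type} (f : A -> R) (l l' : list A) :
  list_sum f (l ++ l') = list_sum f l + list_sum f l'.
Proof. induction l as [| a l ih]; simpl; [lra | unfold list_sum in *; lra]. Qed.

Lemma list_sum_le {A : Type} (f g : A -> R) (l : list A) :
  (forall a, In a l -> f a <= g a) -> list_sum f l <= list_sum g l.
Proof.
induction l as [| a l ih]; simpl; intros h; [lra |].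
apply Rplus_le_compat; [apply h; auto | apply ih; auto].
Qed.

Lemma list_sum_plus {A : Type} (f g : A -> R) (l : list A) :
  list_sum (fun a => f a + g a) l = list_sum f l + list_sum g l.
Proof. induction l as [| a l ih]; simpl; [lra | rewrite ih; lra]. Qed.

Lemma list_sum_const {A : Type} (r : R) (l : list A) :
  list_sum (fun _ => r) l = INR (length l) * r.
Proof.
induction l as [| a l ih]; [simpl; lra |].
change (length (a :: l)) with (S (length l)); rewrite S_INR; simpl; rewrite ih; lra.
Qed.

Lemma list_sum_nonneg {A : Type} (f : A -> R) (l : list A) :
  (forall a, 0 <= f a) -> 0 <= list_sum f l.
Proof.
intros h; induction l as [| a l ih]; simpl; [lra | specialize (h a); lra].
Qed.

Lemma list_sum_In {A : Type} (f : A -> R) (l : list A) (a : A) :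
  (forall b, 0 <= f b) -> In a l -> f a <= list_sum f l.
Proof.
intros h; induction l as [| b l ih]; simpl; [tauto |].
intros [-> | hi].
- pose proof (list_sum_nonneg f l h); lra.
- specialize (ih hi); specialize (h b); lra.
Qed.

(** These are the pairs a < b <= c, grouped by the larger index, so that passing to [S c] only adds
    the pairs ending in [S c]. *)
Fixpoint pairs (c : nat) : list (nat * nat) :=
  match c with
  | O => nil
  | S c' => map (fun i => (i, c)) (seq O c) ++ pairs c'
  end.

(** * The separable amalgam of closures of sequences *)

Section SeparableAmalgam.

Variable N : MetricSpace.

Definition adherent (e : nat -> N) (x : N) : Prop :=
  forall eps, 0 < eps -> exists c, dist N x (e c) < eps.

Definition dist_gap (e e' : nat -> N) (p : nat * nat) : R :=
  Rabs (dist N (e (fst p)) (e (snd p)) - dist N (e' (fst p)) (e' (snd p))).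

Definition gap (e e' : nat -> N) (c : nat) : R := list_sum (dist_gap e e') (pairs c).

Lemma dist_gap_nonneg (e e' : nat -> N) p : 0 <= dist_gap e e' p.
Proof. apply Rabs_pos. Qed.

Lemma gap_nonneg (e e' : nat -> N) c : 0 <= gap e e' c.
Proof. apply list_sum_nonneg, dist_gap_nonneg. Qed.

Lemma gap_refl (e : nat -> N) c : gap e e c = 0.
Proof.
apply Rle_antisym; [| apply gap_nonneg].
rewrite <- (Rmult_0_r (INR (length (pairs c)))), <- list_sum_const.
apply list_sum_le; intros p _; unfold dist_gap; rewrite Rminus_diag, Rabs_R0; lra.
Qed.

Lemma gap_sym (e e' : nat -> N) c : gap e e' c = gap e' e c.
Proof.
apply Rle_antisym; apply list_sum_le; intros p _; unfold dist_gap;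
  rewrite Rabs_minus_sym; lra.
Qed.

Lemma gap_tri (e e' e'' : nat -> N) c : gap e e'' c <= gap e e' c + gap e' e'' c.
Proof.
unfold gap; rewrite <- list_sum_plus; apply list_sum_le; intros p _.
unfold dist_gap; eapply Rle_trans; [| apply Rabs_triang]; right; f_equal; lra.
Qed.

Lemma gap_mono (e e' : nat -> N) c c' : (c <= c')%nat -> gap e e' c <= gap e e' c'.
Proof.
induction 1 as [| c' _ ih]; [lra |].
unfold gap in *; cbn [pairs]; rewrite list_sum_app.
pose proof (list_sum_nonneg (dist_gap e e') (map (fun i => (i, S c')) (seq O (S c')))
  (dist_gap_nonneg e e')); lra.
Qed.

(** For c < c' the pair (c, c') is counted in the gap at [c'] but not in the gap at [c]. This
    surplus pays for changing the crossing index in the triangle inequality. *)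
Lemma gap_add (e e' : nat -> N) c c' : (c <= c')%nat ->
  gap e e' c + dist_gap e e' (c, c') <= gap e e' c'.
Proof.
intros h; destruct (Nat.eq_dec c c') as [<- | ne].
- unfold dist_gap; simpl; rewrite !dist_refl, Rminus_diag, Rabs_R0; lra.
- destruct c' as [| c']; [lia |].
  pose proof (gap_mono e e' c c' ltac:(lia)).
  unfold gap in *; cbn [pairs]; rewrite list_sum_app.
  assert (dist_gap e e' (c, S c') <=
    list_sum (dist_gap e e') (map (fun i => (i, S c')) (seq O (S c')))); [| lra].
  apply list_sum_In; [apply dist_gap_nonneg |].
  apply (in_map (fun i => (i, S c'))), in_seq; lia.
Qed.

(** The length of a route that goes to the [c]-th term in one copy, crosses to the [c]-th term of
    the other at the price of the gap, and goes on from there. *)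
Definition glue_cost (p q : (nat -> N) * N) (c : nat) : R :=
  dist N (snd p) (fst p c) + dist N (snd q) (fst q c) + gap (fst p) (fst q) c.

Lemma glue_cost_nonneg p q c : 0 <= glue_cost p q c.
Proof.
unfold glue_cost; pose proof (gap_nonneg (fst p) (fst q) c).
pose proof (dist_nonneg N (snd p) (fst p c)).
pose proof (dist_nonneg N (snd q) (fst q c)); lra.
Qed.

Lemma glue_cost_sym p q c : glue_cost p q c = glue_cost q p c.
Proof. unfold glue_cost; rewrite gap_sym; lra. Qed.

(** Both routes are made to cross at the smaller index [c]. The detour from [e'' c'] to [e'' c]
    costs at most d(e' c, e' c') plus the discrepancy at (c, c'): the first is bounded through [y],
    the second is absorbed by [gap_add]. *)
Lemma glue_cost_tri_le p q r c c' : (c <= c')%nat ->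
  glue_cost p r c <= glue_cost p q c + glue_cost q r c'.
Proof.
intros h; destruct p as [e x], q as [e' y], r as [e'' z]; unfold glue_cost; simpl.
pose proof (gap_tri e e' e'' c).
pose proof (gap_add e' e'' c c' h) as hg; unfold dist_gap in hg; simpl in hg.
pose proof (dist_tri N z (e'' c') (e'' c)) as h1; rewrite (dist_sym N (e'' c')) in h1.
pose proof (dist_tri N (e' c) y (e' c')) as h2; rewrite (dist_sym N _ y) in h2.
pose proof (Rle_abs (- (dist N (e' c) (e' c') - dist N (e'' c) (e'' c')))) as h3.
rewrite Rabs_Ropp in h3; lra.
Qed.

Definition glue_dist (p q : (nat -> N) * N) : R := infimum (glue_cost p q).

Lemma glue_dist_le p q c : glue_dist p q <= glue_cost p q c.
Proof. apply infimum_spec, glue_cost_nonneg. Qed.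

Lemma glue_dist_approx p q eps : 0 < eps -> exists c, glue_cost p q c < glue_dist p q + eps.
Proof. apply infimum_spec, glue_cost_nonneg. Qed.

Lemma glue_dist_sym p q : glue_dist p q = glue_dist q p.
Proof.
unfold glue_dist; f_equal; apply functional_extensionality, glue_cost_sym.
Qed.

Lemma glue_dist_tri p q r : glue_dist p r <= glue_dist p q + glue_dist q r.
Proof.
apply Rle_plus_epsilon; intros eps heps.
destruct (glue_dist_approx p q (eps / 2)) as [c hc]; [lra |].
destruct (glue_dist_approx q r (eps / 2)) as [c' hc']; [lra |].
destruct (Nat.le_ge_cases c c') as [l | l].
- pose proof (glue_cost_tri_le p q r c c' l); pose proof (glue_dist_le p r c); lra.
(* The other order of the indices is the same estimate for the reversed route. *)
- pose proof (glue_cost_tri_le r q p c' c l) as h.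
  rewrite (glue_cost_sym r p), (glue_cost_sym r q), (glue_cost_sym q p) in h.
  pose proof (glue_dist_le p r c'); lra.
Qed.

(** Inside one copy the gaps vanish. The lower bound is the triangle inequality through [e c]; the
    upper bound takes [e c] close to [x]. *)
Lemma glue_dist_same e x y : adherent e x -> glue_dist (e, x) (e, y) = dist N x y.
Proof.
intros hx; apply Rle_antisym; apply Rle_plus_epsilon; intros eps heps.
- destruct (hx (eps / 2)) as [c hc]; [lra |].
  pose proof (glue_dist_le (e, x) (e, y) c) as h; unfold glue_cost in h; simpl in h.
  rewrite gap_refl in h.
  pose proof (dist_tri N y x (e c)) as h'; rewrite (dist_sym N y x) in h'; lra.
- destruct (glue_dist_approx (e, x) (e, y) eps heps) as [c hc].
  unfold glue_cost in hc; simpl in hc; rewrite gap_refl in hc.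
  pose proof (dist_tri N x (e c) y) as h; rewrite (dist_sym N (e c)) in h; lra.
Qed.

Definition rounded (e : nat -> N) (k : nat) (p : nat * nat) : nat :=
  Z.to_nat (up (dist N (e (fst p)) (e (snd p)) * INR k)).

(** Equal roundings put both distances, scaled by [INR k], in one half-open interval of length 1. *)
Lemma rounded_eq e e' k p : (0 < k)%nat ->
  rounded e k p = rounded e' k p -> dist_gap e e' p <= / INR k.
Proof.
unfold rounded, dist_gap; intros hk.
pose proof (dist_nonneg N (e (fst p)) (e (snd p))) as h.
pose proof (dist_nonneg N (e' (fst p)) (e' (snd p))) as h'.
revert h h'; generalize (dist N (e (fst p)) (e (snd p))).
generalize (dist N (e' (fst p)) (e' (snd p))); intros b a ha hb eq.
apply lt_0_INR in hk.
assert (pos : forall r, 0 <= r -> (0 <= up r)%Z).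
{ intros r hr; apply le_IZR; pose proof (archimed r); lra. }
(* [Z.to_nat] loses nothing here, since the rounded values are nonnegative. *)
apply Z2Nat.inj in eq; [| apply pos; nra | apply pos; nra].
destruct (archimed (a * INR k)) as [a1 a2], (archimed (b * INR k)) as [b1 b2].
rewrite <- eq in *.
apply (Rmult_le_reg_r (INR k)); [exact hk |].
rewrite Rinv_l by lra; rewrite <- (Rabs_pos_eq (INR k)) by lra.
rewrite <- Rabs_mult; apply Rabs_le; nra.
Qed.

(* Points at distance less than [/ INR k] from the [c]-th term of their sequence, with
   the distances between the first terms of that sequence rounded to precision
   [/ INR j]. *)
Definition glue_cell (l : nat * nat * nat * list nat) (p : (nat -> N) * N) : Prop :=
  let '(c, k, j, v) := l in
  (0 < j)%nat /\ dist N (snd p) (fst p c) < / INR k /\ v = map (rounded (fst p) j) (pairs c).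

Lemma glue_cell_small p eps : adherent (fst p) (snd p) -> 0 < eps ->
  exists l, glue_cell l p /\
    forall q r, glue_cell l q -> glue_cell l r -> glue_dist q r < eps.
Proof.
intros hp heps.
(* Each of the two points is within eps/4 of its [c]-th term, which leaves eps/2 for the gap. *)
destruct (archimed_cor1 (eps / 4)) as [k [hk k0]]; [lra |].
destruct (hp (/ INR k)) as [c hc]; [apply Rinv_0_lt_compat, lt_0_INR, k0 |].
set (len := INR (length (pairs c))).
assert (hlen : 0 <= len) by apply pos_INR.
(* The gap is a sum of [len] terms, each at most [/ INR j]; dividing by [len + 1] also covers the
   empty sum at c = 0. *)
destruct (archimed_cor1 (eps / 2 / (len + 1))) as [j [hj j0]].
{ apply Rdiv_lt_0_compat; lra. }
exists (c, k, j, map (rounded (fst p) j) (pairs c)); split; [simpl; auto |].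
intros q r [_ [hq eq]] [_ [hr er]].
pose proof (glue_dist_le q r c) as h; unfold glue_cost in h.
assert (hg : gap (fst q) (fst r) c <= len * / INR j).
{ unfold len; rewrite <- list_sum_const; apply list_sum_le; intros a ha.
  apply rounded_eq; [exact j0 |].
  rewrite eq in er; exact (ext_in_map er a ha). }
assert (0 < / INR j) by (apply Rinv_0_lt_compat, lt_0_INR, j0).
apply (Rmult_lt_compat_r (len + 1)) in hj; [| lra].
replace (eps / 2 / (len + 1) * (len + 1)) with (eps / 2) in hj by (field; lra).
nra.
Qed.

Lemma separable_amalgam (n : nat) (T : Type) (E : T -> nat -> N) :
  card_le_aleph n T -> card_le_aleph n N ->
  exists S : MetricSpace, separable S /\ card_le_aleph n S /\
    forall t, exists g : {x | adherent (E t) x} -> S,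
      forall a b, dist S (g a) (g b) = dist N (proj1_sig a) (proj1_sig b).
Proof.
intros hT hN.
set (P := {p : T * N | adherent (E (fst p)) (snd p)}).
set (pt := fun p : P => (E (fst (proj1_sig p)), snd (proj1_sig p))).
destruct (metric_quotient P (fun p q => glue_dist (pt p) (pt q)))
  as [S [pi [onto iso]]].
- intros [[t x] h]; unfold pt; simpl; rewrite glue_dist_same by exact h.
  apply dist_refl.
- intros p q; apply glue_dist_sym.
- intros p q r; apply glue_dist_tri.
- exists S; split; [| split].
  + apply (separable_of_countable_cover S (nat * nat * nat * list nat)
      (fun l u => exists p, pi p = u /\ glue_cell l (pt p))).
    * apply (embeds_trans _ (list nat)); [| apply list_nat_countable].
      exists (fun l => let '(c, k, j, v) := l in c :: k :: j :: v).
      intros [[[c k] j] v] [[[c' k'] j'] v'] e; congruence.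
    * intros u eps heps; destruct (onto u) as [p hp].
      destruct (glue_cell_small (pt p) eps (proj2_sig p) heps) as [l [hl small]].
      exists l; split; [eauto |].
      intros y z [q [<- hq]] [r [<- hr]]; rewrite iso; auto.
  + apply (card_le_aleph_embeds n _ P); [exact (embeds_of_onto _ _ pi onto) |].
    apply (card_le_aleph_embeds n _ (T * N)); [apply embeds_sig |].
    apply (card_le_aleph_fibres n _ T fst hT); intros t.
    apply (card_le_aleph_embeds n _ N); [| exact hN].
    exists (fun p => snd (proj1_sig p)).
    intros [[a x] ha] [[b y] hb] e; simpl in *; subst; reflexivity.
  + intros t.
    exists (fun a => pi (exist (fun p => adherent (E (fst p)) (snd p))
      (t, proj1_sig a) (proj2_sig a))).
    intros [a ha] [b hb]; rewrite iso; apply glue_dist_same, ha.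
Qed.

End SeparableAmalgam.

(** * Discrete extensions and separable envelopes *)

Lemma exists_pointed_norm (M : MetricSpace) :
  exists h : M -> R, (forall a b, h a <= dist M a b + h b) /\
    forall a b, dist M a b <= h a + h b.
Proof.
destruct (classic (inhabited M)) as [[p] | empty].
- exists (fun a => dist M a p); split; intros a b; [apply dist_tri |].
  rewrite (dist_sym M b p); apply dist_tri.
- exists (fun _ => 0); split; intros a; exfalso; apply empty; constructor; exact a.
Qed.

Lemma exists_discrete_extension (M : MetricSpace) (K : Type) :
  exists dK : M + K -> M + K -> R,
    (forall x y, dK x y = 0 <-> x = y) /\ (forall x y, dK x y = dK y x) /\
    (forall x y z, dK x z <= dK x y + dK y z) /\
    forall a b, dK (inl a) (inl b) = dist M a b.
Proof.
destruct (exists_pointed_norm M) as [h [h1 h2]].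
assert (h0 : forall a, 0 <= h a).
{ intros a; specialize (h2 a a); rewrite dist_refl in h2; lra. }
(* New points are at distance 1 from each other and at distance [h a + 1] from [a], with [h] the
   distance to a base point; the summand 1 keeps old and new points apart. *)
exists (fun x y => match x, y with
  | inl a, inl b => dist M a b
  | inl a, inr _ | inr _, inl a => h a + 1
  | inr k, inr l => if excluded_middle_informative (k = l) then 0 else 1
  end).
split; [| split; [| split]].
- intros [a | k] [b | l].
  + rewrite dist_eq0; split; congruence.
  + split; [specialize (h0 a); lra | discriminate].
  + split; [specialize (h0 b); lra | discriminate].
  + destruct (excluded_middle_informative (k = l)) as [-> | ne]; split; auto; try lra.
    intros e; congruence.
- intros [a | k] [b | l]; auto using dist_sym.
  destruct (excluded_middle_informative (k = l)), (excluded_middle_informative (l = k));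
    congruence.
- assert (unit_le : forall k l : K,
    0 <= (if excluded_middle_informative (k = l) then 0 else 1) <= 1).
  { intros k l; destruct (excluded_middle_informative (k = l)); lra. }
  intros [a | k] [b | l] [c | m].
  + apply dist_tri.
  + specialize (h1 a b); lra.
  + specialize (h2 a c); lra.
  + specialize (unit_le l m); lra.
  + specialize (h1 c b); rewrite dist_sym in h1; lra.
  + specialize (unit_le k m); specialize (h0 b); lra.
  + specialize (unit_le k l); lra.
  + destruct (excluded_middle_informative (k = l)) as [-> |]; [lra |].
    pose proof (unit_le k m); pose proof (unit_le l m); lra.
- reflexivity.
Qed.

Lemma bi_lipschitz_weaken (X Y : MetricSpace) (lam mu : R) (f : X -> Y) :
  lam <= mu -> bi_lipschitz X Y lam f -> bi_lipschitz X Y mu f.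
Proof.
intros h [hi hf]; split; [exact hi |]; intros a b ne; destruct (hf a b ne) as [h1 h2].
pose proof (dist_nonneg X a b); pose proof (dist_nonneg Y (f a) (f b)).
split; nra.
Qed.

Lemma bi_lipschitz_adherent (M N : MetricSpace) (lam : R) (f : M -> N)
    (s : nat -> M) (e : nat -> N) :
  0 < lam -> bi_lipschitz M N lam f ->
  (forall x eps, 0 < eps -> exists k, dist M x (s k) < eps) ->
  (forall k, exists j, e j = f (s k)) -> forall x, adherent N e (f x).
Proof.
intros hl [_ hf] dense he x eps heps.
destruct (dense x (eps / lam)) as [k hk]; [apply Rdiv_lt_0_compat; lra |].
destruct (he k) as [j hj]; exists j; rewrite hj.
(* The Lipschitz bound is strict and only speaks of distinct points, so equality is treated
   apart. *)
destruct (classic (x = s k)) as [<- | ne]; [rewrite dist_refl; exact heps |].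
apply (Rlt_trans _ (lam * dist M x (s k))); [apply hf, ne |].
apply (Rmult_lt_compat_l lam) in hk; [| exact hl].
replace (lam * (eps / lam)) with eps in hk by (field; lra); exact hk.
Qed.

Definition separably_universal (N S : MetricSpace) : Prop :=
  forall M : MetricSpace, separable M -> almost_embeds M N -> almost_embeds M S.

Lemma exists_separable_envelope (n : nat) (N : MetricSpace) :
  card_le_aleph n N ->
  exists S : MetricSpace, separable S /\ card_le_aleph n S /\ separably_universal N S.
Proof.
intros hN.
destruct (countable_covering n N hN) as [T [E [hT cov]]].
destruct (separable_amalgam N n T E hT hN) as [S [sepS [hS iso]]].
exists S; split; [exact sepS | split; [exact hS |]].
intros M sepM hM.
destruct (classic (inhabited M)) as [[x0] | empty].
2: { intros lam _.
  assert (f : M -> S) by (intros x; exfalso; apply empty; constructor; exact x).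
  exists f; split; intros a; exfalso; apply empty; constructor; exact a. }
destruct (separable_dense_sequence M x0 sepM) as [s dense].
(* The constants 1 + 1/(k+1) decrease to 1; the shift avoids the inverse of 0. *)
destruct (dependent_choice nat (fun _ => M -> N)
  (fun k f => bi_lipschitz M N (1 + / INR (1 + k)) f)) as [f hf].
{ intros k; apply hM; assert (0 < / INR (1 + k)); [| lra].
  apply Rinv_0_lt_compat, lt_0_INR; lia. }
(* The pairing merges the images of the dense sequence under all the [f k] into one sequence, so a
   single index [t] serves every [k]. *)
destruct (cov (fun m => let '(k, j) := Cantor.of_nat m in f k (s j))) as [t ht].
assert (adh : forall k x, adherent N (E t) (f k x)).
{ intros k; apply (bi_lipschitz_adherent M N (1 + / INR (1 + k)) (f k) s (E t));
    [| apply hf | exact dense |].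
  - assert (0 < / INR (1 + k)); [| lra].
    apply Rinv_0_lt_compat, lt_0_INR; lia.
  - intros j; destruct (ht (Cantor.to_nat (k, j))) as [i hi].
    rewrite Cantor.cancel_of_to in hi; eauto. }
destruct (iso t) as [g hg].
intros lam hlam; destruct (archimed_cor1 (lam - 1)) as [k [hk k0]]; [lra |].
destruct k as [| k]; [lia |].
assert (hle : 1 + / INR (1 + k) <= lam) by (change (1 + k)%nat with (Datatypes.S k); lra).
destruct (bi_lipschitz_weaken M N _ lam (f k) hle (hf k)) as [_ hb].
exists (fun x => g (exist _ (f k x) (adh k x))); split.
(* If distinct points had equal images, the second bound would give d(a, b) < lam * 0. *)
- intros a b e; apply NNPP; intros ne; destruct (hb a b ne) as [_ l].
  assert (z : dist S (g (exist _ (f k a) (adh k a))) (g (exist _ (f k b) (adh k b))) = 0)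
    by (apply dist_eq0, e).
  rewrite hg in z; simpl in z; rewrite z in l.
  pose proof (dist_nonneg M a b); lra.
- intros a b ne; rewrite hg; exact (hb a b ne).
Qed.

(** The cofinal family is only assumed to absorb spaces of cardinality exactly aleph_(m+1), so a
    smaller space is first padded with a discrete set of that size. *)
Lemma exists_extension_card_aleph (m : nat) (M : MetricSpace) :
  card_le_aleph (S m) M ->
  exists M' : MetricSpace, card_eq_aleph (S m) M' /\
    exists j : M -> M', injective j /\ forall a b, dist M' (j a) (j b) = dist M a b.
Proof.
intros hM; destruct (exists_card_aleph_succ m) as [K [hK nK]].
destruct (exists_discrete_extension M K) as [dK [d0 [dsym [dtri dM]]]].
exists (MkMetricSpace (M + K) dK d0 dsym dtri); split; [split |].
- apply card_le_aleph_sum; assumption.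
- intros h; apply nK, (card_le_aleph_embeds m _ (M + K)); [| exact h].
  exists inr; intros a b e; congruence.
- exists inl; split; [intros a b e; congruence | exact dM].
Qed.

Lemma almost_embeds_isometry (M M' N : MetricSpace) (j : M -> M') :
  injective j -> (forall a b, dist M' (j a) (j b) = dist M a b) ->
  almost_embeds M' N -> almost_embeds M N.
Proof.
intros hj iso h lam hl; destruct (h lam hl) as [f [fi hf]].
exists (fun x => f (j x)); split; [intros a b e; apply hj, fi, e |].
intros a b ne; rewrite <- iso; apply hf; intros e; apply ne, hj, e.
Qed.

Theorem theorem5p1 (n : nat) (hn : (1 <= n)%nat)
  (I : Type) (N : I -> MetricSpace)
  (hN : forall i, card_eq_aleph n (N i))
  (hcof : forall M : MetricSpace, card_eq_aleph n M ->
            exists i, almost_embeds M (N i)) :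
  exists (J : Type) (S : J -> MetricSpace),
    (exists g : J -> I, injective g) /\
    (forall j, separable (S j) /\ card_le_aleph n (S j)) /\
    (forall M : MetricSpace, separable M -> card_le_aleph n M ->
       exists j, almost_embeds M (S j)).
Proof.
destruct n as [| m]; [lia |].
destruct (dependent_choice I (fun _ => MetricSpace) (fun i S =>
  separable S /\ card_le_aleph (Datatypes.S m) S /\ separably_universal (N i) S))
  as [S hS].
{ intros i; apply exists_separable_envelope, hN. }
exists I, S; split; [exists (fun i => i); intros a b e; exact e | split].
- intros i; destruct (hS i) as [h1 [h2 _]]; auto.
- intros M sepM hM.
  destruct (exists_extension_card_aleph m M hM) as [M' [hM' [j [hj iso]]]].
  destruct (hcof M' hM') as [i hi]; exists i.
  apply (proj2 (proj2 (hS i))); [exact sepM |].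
  exact (almost_embeds_isometry M M' (N i) j hj iso hi).
Qed.
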